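(* The crossing number of the pancake graph $P_4$ is $6$, i.e. $cr(P_4)=6$.
   Context: The $n$-dimensional pancake graph $P_n$ has as vertices the $n!$ permutations $a_1a_2\cdots a_n$ of the symbols $1,2,\dots,n$; two vertices are adjacent iff one is obtained from the other by reversing a prefix of length $k$ for some $2\le k\le n$, i.e. $a_1\cdots a_ka_{k+1}\cdots a_n$ is adjacent to $a_k\cdots a_1a_{k+1}\cdots a_n$. The crossing number $cr(G)$ of a graph $G$ is the minimum number of pairwise edge crossings over all drawings of $G$ in the plane. *)

(* Defs.v *)
From HB Require Import structures.
From mathcomp Require Import all_boot all_order all_algebra all_fingroup.
From mathcomp Require Import finmap.
From mathcomp Require Import all_classical all_reals all_analysis.

Set Implicit Arguments.
Unset Strict Implicit.
Unset Printing Implicit Defensive.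

Import Order.TTheory GRing.Theory Num.Theory.
Import numFieldNormedType.Exports.
Local Open Scope classical_set_scope.
Local Open Scope ring_scope.

Record sgraph := SGraph {
  vertex :> finType;
  adj : rel vertex;
  adj_sym : symmetric adj;
  adj_irr : irreflexive adj }.

Definition edges (G : sgraph) : {set {set G}} :=
  [set [set p.1; p.2] | p in [set p : G * G | adj p.1 p.2]]%SET.

Section Drawings.
Variable R : realType.

Local Notation plane := (R * R)%type.

Definition open_arc (f : R -> plane) : set plane := f @` `]0, 1[.

(* The open arcs A and B cross properly (rather than touch) at p: some
   homeomorphism h from an open neighbourhood U of p onto an open set V of the
   plane, with inverse g, sends p to the origin and straightens A and B
   near p to the two coordinate axes. *)
Definition crosses_at (A B : set plane) (p : plane) : Prop :=
  exists (U V : set plane) (h g : plane -> plane),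
    [/\ open U, open V, U p & h p = (0, 0)] /\
    [/\ {within U, continuous h}, {within V, continuous g},
        (forall q, U q -> V (h q) /\ g (h q) = q)
      & (forall q, V q -> U (g q) /\ h (g q) = q)] /\
    (forall q, U q ->
       (A q <-> (h q).2 = 0) /\ (B q <-> (h q).1 = 0)).

(* The pairs ({E, F}, p) where p is a common point, other than an endpoint, of
   the distinct edges E and F: a point lying on m edges counts once for each of
   the m(m-1)/2 pairs. *)
Definition crossings (G : sgraph) (curve : {set G} -> R -> plane) :
    set ({set {set G}} * plane) :=
  [set c | exists E F : {set G},
     [/\ E \in edges G, F \in edges G, E != F & c.1 = [set E; F]%SET] /\
     open_arc (curve E) c.2 /\ open_arc (curve F) c.2].

(* [curve E] is only constrained when E is an edge, and then only on [0, 1]. *)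
Record drawing (G : sgraph) := Drawing {
  position : G -> plane;
  curve : {set G} -> R -> plane;
  position_inj : injective position;
  curve_cont : forall E, E \in edges G ->
    {within `[0, 1], continuous (curve E)};
  curve_simple : forall E, E \in edges G ->
    {in `[0, 1]%R &, injective (curve E)};
  curve_ends : forall E, E \in edges G -> exists x y : G,
    [/\ E = [set x; y]%SET, curve E 0 = position x & curve E 1 = position y];
  curve_avoids : forall E (v : G), E \in edges G ->
    ~ open_arc (curve E) (position v);
  curve_proper : forall E F p, E \in edges G -> F \in edges G -> E != F ->
    open_arc (curve E) p -> open_arc (curve F) p ->
    crosses_at (open_arc (curve E)) (open_arc (curve F)) p;
  crossings_finite : finite_set (crossings curve) }.

(* [fset_set] sends an infinite set to the empty one, but [crossings_finite]
   rules that case out. *)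
Definition crossing_count (G : sgraph) (D : drawing G) : nat :=
  #|` fset_set (crossings (curve D))|.

Definition min_crossing_count (G : sgraph) (k : nat) : Prop :=
  (exists D : drawing G, crossing_count D = k) /\
  (forall D : drawing G, (k <= crossing_count D)%N).

(* The default value 0 would only be used for a graph without drawings, and
   every finite graph has one. *)
Definition crossing_number (G : sgraph) : nat :=
  xget 0%N [set k | min_crossing_count G k].

End Drawings.

Section Pancake.
Variable n : nat.

(* The permutation s stands for the word s(0) s(1) ... s(n-1). *)
Definition word (s : 'S_n) : seq 'I_n := [seq s i | i <- enum 'I_n].

Definition reverse_prefix (k : nat) (w : seq 'I_n) : seq 'I_n :=
  rev (take k w) ++ drop k w.

Definition pancake_adj (s t : 'S_n) : bool :=
  [exists k : 'I_n.+1, (2 <= k)%N && (word t == reverse_prefix k (word s))].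

Lemma pancake_adj_sym : symmetric pancake_adj.
Proof.
suff H s t : pancake_adj s t -> pancake_adj t s.
  by move=> s t; apply/idP/idP; apply: H.
move=> /existsP[k /andP[k2 /eqP Hk]]; apply/existsP; exists k; rewrite k2 /=.
have sz : size (word s) = n by rewrite size_map size_enum_ord.
have sk : size (rev (take k (word s))) = k.
  by rewrite size_rev size_takel // sz -ltnS ltn_ord.
rewrite Hk /reverse_prefix take_size_cat // drop_size_cat // revK.
by rewrite cat_take_drop.
Qed.

Lemma pancake_adj_irr : irreflexive pancake_adj.
Proof.
move=> s; apply/negbTE/negP => /existsP[k /andP[k2 /eqP Hk]].
have sz : size (word s) = n by rewrite size_map size_enum_ord.
have us : uniq (word s) by rewrite map_inj_uniq ?enum_uniq //; apply: perm_inj.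
have kn : (k <= n)%N by rewrite -ltnS ltn_ord.
have n0 : (0 < n)%N by apply: leq_trans kn; apply: leq_trans k2.
pose x0 : 'I_n := Ordinal n0.
have k0 : (0 < k)%N by apply: leq_trans k2.
have szt : size (take k (word s)) = k by rewrite size_takel ?sz.
have : nth x0 (word s) 0 = nth x0 (word s) k.-1.
  rewrite {1}Hk /reverse_prefix nth_cat size_rev szt k0 nth_rev szt //.
  by rewrite nth_take subn1 // prednK.
move/eqP; rewrite nth_uniq ?sz //; last by rewrite prednK.
by move: k2; case: (nat_of_ord k) => [|[|m]].
Qed.

Definition pancake_graph : sgraph := SGraph pancake_adj_sym pancake_adj_irr.

End Pancake.

(* Main.v *)
Require Import Defs.
From mathcomp Require Import all_boot all_order all_algebra all_fingroup finmap.
From mathcomp Require Import all_classical all_reals all_analysis.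
From mathcomp Require Import ring lra.

(* Lower bound.  If the disjoint edges ab and cd do not meet, then modulo 2
     w(ab, c) + w(ab, d) + w(cd, a) + w(cd, b) =
       [a < c] + [b < c] + [a < d] + [b < d],
   where w(e, v) counts the crossings of the curve e with the horizontal half-line
   going right from v, and < is a lexicographic order on the positions of the
   vertices: this follows by approximating the curves by polygonal lines.  Summed
   over the pairs of edges on independent paths of a subdivision of K_{3,3}, the
   terms w cancel and the right-hand sides add up to 1.  Hence two edges on
   independent paths meet in each such subdivision.  The pancake graph has a
   subdivision of K_{3,3} with 48 images under automorphisms such that each pair of
   edges is on independent paths of at most 8 of them, so that at least 48 / 8 = 6
   pairs of edges cross.

   Upper bound.  There is a drawing with straight edges and 6 crossings. *)

Set Implicit Arguments.
Unset Strict Implicit.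
Unset Printing Implicit Defensive.

Import Order.TTheory GRing.Theory Num.Theory.
Import numFieldNormedType.Exports.
Local Open Scope classical_set_scope.
Local Open Scope ring_scope.

(** * Crossings of a half-line by polygonal lines *)

Definition det (R : comPzRingType) (u w : R * R) : R := u.1 * w.2 - u.2 * w.1.

Section RayParity.
Variable R : realFieldType.
Implicit Types a u w : R * R.

Definition dot u w : R := u.1 * w.1 + u.2 * w.2.

(* The lexicographic half-plane, so that upper (- u) = ~~ upper u for u != 0. *)
Definition upper u : bool := (0 < u.2) || ((u.2 == 0) && (0 < u.1)).

(* Whether the segment from u to w crosses the half-line of the (x, 0), x > 0,
   provided that 0 is not on this segment. *)
Definition ray_crossing u w : bool :=
  [&& upper u, ~~ upper w & det u w < 0] ||
  [&& ~~ upper u, upper w & 0 < det u w].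

Lemma upperN u : u != 0 -> upper (- u) = ~~ upper u.
Proof.
case: u => x y; rewrite /upper /= !oppr_gt0 oppr_eq0 => nz.
case: (ltgtP y 0) => //= y0; case: (ltgtP x 0) => //= x0.
by rewrite x0 y0 eqxx in nz.
Qed.

Lemma half_plane_det a u w : 0 < dot a u -> 0 < dot a w ->
  upper u -> ~~ upper w -> a.1 * det u w < 0.
Proof.
case: a u w => a1 a2 [u1 u2] [w1 w2]; rewrite /dot /det /upper /=.
move=> au aw uu uw.
have -> : a1 * (u1 * w2 - u2 * w1) =
  (a1 * u1 + a2 * u2) * w2 - (a1 * w1 + a2 * w2) * u2 by ring.
move: uw; rewrite negb_or -leNgt => /andP[w2le w2e].
case/orP: uu => [u2gt|/andP[/eqP u20 u1gt]].
  have := mulr_gt0 aw u2gt; have := mulr_ge0_le0 (ltW au) w2le; lra.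
subst u2; rewrite [X in _ - X]mulr0 subr0 pmulr_rlt0 // lt_neqAle w2le andbT.
apply/eqP => w20; subst w2; move: w2e; rewrite eqxx /= -leNgt => w1le.
have a1gt : 0 < a1 by move: au; rewrite mulr0 addr0 pmulr_lgt0.
by have := mulr_ge0_le0 (ltW a1gt) w1le; lra.
Qed.

Lemma detC u w : det w u = - det u w.
Proof. by rewrite /det; ring. Qed.

Lemma mulr_lt0_sign (x y : R) : x * y < 0 -> (y < 0) = (0 < x).
Proof.
case: (ltgtP x 0) => [x0|x0|->]; last by rewrite mul0r ltxx.
- by rewrite nmulr_rlt0 // => y0; rewrite ltNge ltW.
- by rewrite pmulr_rlt0.
Qed.

(* The half-plane of the u with 0 < dot a u meets the first axis only on the side
   of the sign of a.1. *)
Lemma half_plane_ray_crossing a u w : 0 < dot a u -> 0 < dot a w ->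
  ray_crossing u w = (0 < a.1) && (upper u (+) upper w).
Proof.
move=> au aw; rewrite /ray_crossing.
have := half_plane_det au aw; have := half_plane_det aw au.
rewrite (detC u w).
case: (upper u); case: (upper w) => //=; rewrite ?andbF ?orbF ?andbT //.
- by move=> _ /(_ isT isT)/mulr_lt0_sign.
- by move=> /(_ isT isT)/mulr_lt0_sign <-; rewrite oppr_lt0.
Qed.

Lemma ray_crossingN a u w : 0 < dot a u -> 0 < dot a w ->
  ray_crossing (- u) (- w) = ray_crossing u w (+) (upper u (+) upper w).
Proof.
move=> au aw.
have nz v : 0 < dot a v -> v != 0.
  by move=> h; apply/eqP => v0; move: h; rewrite v0 /dot /= !mulr0 addr0 ltxx.
have aNN v : dot (- a) (- v) = dot a v by rewrite /dot /=; ring.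
rewrite (half_plane_ray_crossing au aw).
rewrite (@half_plane_ray_crossing (- a)) ?aNN // !upperN ?nz //= oppr_gt0.
rewrite addbN addNb negbK.
case E: (upper u (+) upper w); rewrite ?andbF //= !andbT addbT.
suff a0 : a.1 != 0 by case: (ltgtP a.1 0) a0.
apply/eqP => a0; case: (boolP (upper u)) E => uu; case: (boolP (upper w)) => // uw _.
- by have := half_plane_det au aw uu uw; rewrite a0 mul0r ltxx.
- by have := half_plane_det aw au uw uu; rewrite a0 mul0r ltxx.
Qed.

Definition ray_parity (M : nat) (P : nat -> R * R) (v : R * R) : bool :=
  \big[addb/false]_(i < M) ray_crossing (P i - v) (P i.+1 - v).

Lemma addb_telescope (f : nat -> bool) (m : nat) :
  \big[addb/false]_(i < m) (f i (+) f i.+1) = f 0%N (+) f m.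
Proof.
elim: m => [|m IH]; first by rewrite big_ord0 addbb.
by rewrite big_ord_recr /= IH; case: (f 0%N); case: (f m); case: (f m.+1).
Qed.

(* The vectors P i - Q j form a grid whose cells each lie in an open half-plane, so
   that the crossings of the ray cancel modulo 2 around each cell, hence around the
   boundary of the grid.  On two of the four sides, P i - Q j has the opposite sign
   of the vectors counted by ray_parity, which gives the right-hand side. *)
Lemma polyline_parity (M : nat) (P Q : nat -> R * R) :
  (forall i j i' j', (i < M)%N -> (j < M)%N ->
     (i <= i' <= i.+1)%N -> (j <= j' <= j.+1)%N ->
     0 < dot (P i - Q j) (P i' - Q j')) ->
  ray_parity M P (Q 0%N) (+) ray_parity M P (Q M) (+)
  ray_parity M Q (P 0%N) (+) ray_parity M Q (P M) =
  (upper (Q 0%N - P 0%N) (+) upper (Q 0%N - P M)) (+)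
  (upper (Q M - P 0%N) (+) upper (Q M - P M)).
Proof.
move=> cell.
pose F i j := P i - Q j.
pose row j := \big[addb/false]_(i < M) ray_crossing (F i j) (F i.+1 j).
pose col i := \big[addb/false]_(j < M) ray_crossing (F i j) (F i j.+1).
have rowE j : (j < M)%N -> row j (+) row j.+1 =
    ray_crossing (F 0%N j) (F 0%N j.+1) (+) ray_crossing (F M j) (F M j.+1).
  move=> jM; rewrite -(addb_telescope (fun i => ray_crossing (F i j) (F i j.+1))).
  rewrite /row -big_split /=; apply: eq_bigr => i _.
  have dF i' j' : (i <= i' <= i.+1)%N -> (j <= j' <= j.+1)%N ->
    0 < dot (F i j) (F i' j') by apply: cell.
  have hi : (i <= i <= i.+1)%N by rewrite leqnn leqnSn.
  have hi' : (i <= i.+1 <= i.+1)%N by rewrite leqnn leqnSn.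
  have hj : (j <= j <= j.+1)%N by rewrite leqnn leqnSn.
  have hj' : (j <= j.+1 <= j.+1)%N by rewrite leqnn leqnSn.
  rewrite !(half_plane_ray_crossing (dF _ _ _ _) (dF _ _ _ _)) //.
  by case: (0 < _); do 4!case: (upper _).
have bndE : row 0%N (+) row M = col 0%N (+) col M.
  rewrite -(addb_telescope row) /col -big_split /=.
  by apply: eq_bigr => j _; apply: rowE.
have colN i : (i = 0 \/ i = M)%N ->
    col i = ray_parity M Q (P i) (+) (upper (Q 0%N - P i) (+) upper (Q M - P i)).
  move=> iM; rewrite -(addb_telescope (fun j => upper (Q j - P i))) /col /ray_parity.
  rewrite -big_split /=; apply: eq_bigr => j _.
  have [i0 [i0M hi]] : exists i0, (i0 < M)%N /\ (i0 <= i <= i0.+1)%N.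
    have M0 : (0 < M)%N by apply: leq_ltn_trans (ltn_ord j).
    case: iM => ->; first by exists 0%N.
    by exists M.-1; rewrite ltn_predL M0 prednK // leq_pred leqnn.
  have h j' : (j <= j' <= j.+1)%N -> 0 < dot (Q j - P i0) (Q j' - P i).
    move=> hj; have := cell i0 j i j' i0M (ltn_ord j) hi hj.
    by rewrite /F /dot /=; lra.
  rewrite -(@ray_crossingN (Q j - P i0)) ?opprB //; apply: h;
    by rewrite leqnn leqnSn.
have rp k : ray_parity M P (Q k) = row k by [].
rewrite !rp bndE !colN; [|by right|by left].
by do 2!case: (ray_parity _ _ _); do 4!case: (upper _).
Qed.

End RayParity.

(** * Crossings of a half-line by curves *)

Section Sampling.
Variable R : realType.
Implicit Types (u v w : R * R) (p q : R -> R * R).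

Lemma dot_gt0_near w u v : `|w - u| < `|w| / 4 -> `|w - v| < `|w| / 4 ->
  0 < dot u v.
Proof.
suff main m (w1 w2 u1 u2 v1 v2 : R) : `|w1| = m ->
    `|w1 - u1| < m / 4 -> `|w1 - v1| < m / 4 ->
    `|w2 - u2| < m / 4 -> `|w2 - v2| < m / 4 -> 0 < u1 * v1 + u2 * v2.
  rewrite !prod_normE /= !gt_max => /andP[wu1 wu2] /andP[wv1 wv2].
  rewrite /dot; set m := Num.max _ _ in wu1 wu2 wv1 wv2.
  have [m1|m2] : `|w.1| = m \/ `|w.2| = m.
    by rewrite /m; case: (leP `|w.1| `|w.2|); [right|left].
  - exact: main m1 wu1 wv1 wu2 wv2.
  - by rewrite addrC; exact: main m2 wu2 wv2 wu1 wv1.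
move=> w1m; rewrite !ltr_norml.
move=> /andP[a1 a2] /andP[b1 b2] /andP[c1 c2] /andP[d1 d2].
have m0 : 0 < m by lra.
have sq : 0 <= (u2 + v2) ^+ 2 by exact: sqr_ge0.
have df : 0 < (m / 2 - (u2 - v2)) * (m / 2 + (u2 - v2)) by apply: mulr_gt0; lra.
have [w1E|w1E] : w1 = m \/ w1 = - m.
  by case: (ler0P w1) w1m => _ <-; [right; rewrite opprK|left].
- have : 0 < (u1 - m / 2) * (v1 - m / 2) by apply: mulr_gt0; lra.
  have : 0 < m / 2 * (u1 + v1 - m) by apply: mulr_gt0; lra.
  nra.
- have : 0 < (- u1 - m / 2) * (- v1 - m / 2) by apply: mulr_gt0; lra.
  have : 0 < m / 2 * (- u1 - v1 - m) by apply: mulr_gt0; lra.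
  nra.
Qed.

(* By compactness, on all small enough squares of parameters p x - q y stays in a
   half-plane not containing 0. *)
Lemma near_sample_dot p q :
  {within `[0, 1], continuous p} -> {within `[0, 1], continuous q} ->
  (forall x y, x \in `[0, 1] -> y \in `[0, 1] -> p x != q y) ->
  \forall M \near \oo, forall x y x' y',
    x \in `[0, 1] -> y \in `[0, 1] -> x' \in `[0, 1] -> y' \in `[0, 1] ->
    `|x - x'| <= M.+1%:R^-1 -> `|y - y'| <= M.+1%:R^-1 ->
    0 < dot (p x - q y) (p x' - q y').
Proof.
move=> cp cq pq.
have cpt : compact (`[0, 1] `*` `[0, 1] : set (R * R)).
  by apply: compact_setX; exact: segment_compact.
pose K := fun (M : nat) (z : R * R) => forall x' y' : R,
   x' \in `[0, 1] -> y' \in `[0, 1] ->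
    `|z.1 - x'| <= M.+1%:R^-1 -> `|z.2 - y'| <= M.+1%:R^-1 ->
    0 < dot (p z.1 - q z.2) (p x' - q y').
have loc (r : R -> R * R) x0 (e : R) : {within `[0, 1], continuous r} ->
    x0 \in `[0, 1] -> 0 < e -> exists2 d : R, 0 < d &
    forall x, x \in `[0, 1] -> `|x0 - x| < d -> `|r x0 - r x| < e.
  move=> /subspace_continuousP cr x0I e0.
  have := cr x0 x0I => /cvgrPdist_lt /(_ e e0).
  rewrite near_withinE => /nbhs_ballP[d /= d0 dP]; exists d => // x xI xd.
  by apply: dP.
have cov := (near_covering_withinP _).2 ((compact_near_coveringP _).1 cpt).
have [|M0 _ M0P] := cov nat \oo K _.
  move=> [x0 y0] [/= x0I y0I].
  have e0 : 0 < `|p x0 - q y0| / 8 by rewrite divr_gt0 // normr_gt0 subr_eq0 pq.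
  have [dx dx0 dxP] := loc _ _ _ cp x0I e0.
  have [dy dy0 dyP] := loc _ _ _ cq y0I e0.
  pose d := Num.min dx dy.
  have d20 : 0 < d / 2 by rewrite divr_gt0 // lt_min dx0.
  have nearF x y : x \in `[0, 1] -> y \in `[0, 1] ->
      `|x0 - x| < d -> `|y0 - y| < d ->
      `|(p x0 - q y0) - (p x - q y)| < `|p x0 - q y0| / 4.
    rewrite !lt_min => xI yI /andP[xd _] /andP[_ yd].
    have -> : p x0 - q y0 - (p x - q y) = (p x0 - p x) - (q y0 - q y).
      by rewrite !opprB addrACA [RHS]addrACA [X in _ = _ + X]addrC.
    apply: le_lt_trans (ler_normB _ _) _.
    have := dxP _ xI xd; have := dyP _ yI yd; lra.
  have nball : nbhs (x0, y0) (ball (x0, y0) (d / 2)) by exact: nbhsx_ballx.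
  near=> z M.
  case=> zI1 zI2 x' y' x'I y'I h1 h2.
  have Md : M.+1%:R^-1 < d / 2.
    by near: M; exact: (near_infty_natSinv_lt (PosNum d20)).
  have : ball (x0, y0) (d / 2) z by near: z.
  case=> b1 b2.
  have bnd x0' x x1 : `|x0' - x| < d / 2 -> `|x - x1| <= M.+1%:R^-1 ->
      `|x0' - x1| < d.
    move=> xb xc; have -> : x0' - x1 = (x0' - x) + (x - x1) by rewrite addrA subrK.
    apply: le_lt_trans (ler_normD _ _) _.
    by rewrite [d]splitr ltrD // (le_lt_trans xc Md).
  have dd : d / 2 < d by lra.
  apply: (@dot_gt0_near (p x0 - q y0)); apply: nearF => //.
  - exact: lt_trans b1 dd.
  - exact: lt_trans b2 dd.
  - exact: bnd b1 h1.
  - exact: bnd b2 h2.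
exists M0 => // M /M0P KM x y x' y' xI yI x'I y'I.
by apply: (KM (x, y)).
Unshelve. all: by end_near. Qed.
Definition arc_parity (M : nat) p (v : R * R) : bool :=
  ray_parity M.+1 (fun i => p (i%:R / M.+1%:R)) v.

Lemma disjoint_arc_parity p q :
  {within `[0, 1], continuous p} -> {within `[0, 1], continuous q} ->
  (forall x y, x \in `[0, 1] -> y \in `[0, 1] -> p x != q y) ->
  \forall M \near \oo,
    arc_parity M p (q 0) (+) arc_parity M p (q 1) (+)
    arc_parity M q (p 0) (+) arc_parity M q (p 1) =
    (upper (q 0 - p 0) (+) upper (q 0 - p 1)) (+)
    (upper (q 1 - p 0) (+) upper (q 1 - p 1)).
Proof.
move=> cp cq pq; near=> M.
have small x y x' y' : x \in `[0, 1] -> y \in `[0, 1] -> x' \in `[0, 1] ->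
    y' \in `[0, 1] -> `|x - x'| <= M.+1%:R^-1 -> `|y - y'| <= M.+1%:R^-1 ->
    0 < dot (p x - q y) (p x' - q y').
  by move: x y x' y'; near: M; exact: near_sample_dot.
have Mn0 : M.+1%:R != 0 :> R by rewrite pnatr_eq0.
have P0 (r : R -> R * R) : r 0 = r (0%:R / M.+1%:R) by rewrite mul0r.
have P1 (r : R -> R * R) : r 1 = r (M.+1%:R / M.+1%:R) by rewrite divff.
rewrite !(P0 p) !(P0 q) !(P1 p) !(P1 q).
apply: (@polyline_parity _ M.+1 (fun i => p (i%:R / M.+1%:R))
  (fun i => q (i%:R / M.+1%:R))) => i j i' j' iM jM hi hj.
have inI k : (k <= M.+1)%N -> (k%:R / M.+1%:R : R) \in `[0, 1].
  by move=> kM; rewrite in_itv /= divr_ge0 //= ler_pdivrMr ?ltr0n // mul1r ler_nat.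
have close k k' : (k <= k' <= k.+1)%N ->
    `|k%:R / M.+1%:R - k'%:R / M.+1%:R| <= M.+1%:R^-1 :> R.
  move=> /andP[kk' k'k]; rewrite -mulrBl normrM [X in _ * X]ger0_norm ?invr_ge0 //.
  rewrite ler_piMl ?invr_ge0 // distrC ger0_norm ?subr_ge0 ?ler_nat //.
  by rewrite lerBlDl natr1 ler_nat.
have [/andP[_ hi2] /andP[_ hj2]] := (hi, hj).
apply: small; try exact: close; apply: inI;
  by rewrite ?(ltnW iM) ?(ltnW jM) ?(leq_trans hi2) ?(leq_trans hj2).
Unshelve. all: by end_near. Qed.

End Sampling.

Section DrawingParity.
Variables (R : realType) (G : sgraph) (D : drawing R G).
Implicit Types (a b c d v : G) (E F : {set G}) (M : nat).

Definition arcs_meet E F : Prop :=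
  exists z, open_arc (curve D E) z /\ open_arc (curve D F) z.

Definition above a v : bool := upper (position D v - position D a).

Lemma aboveC a v : a != v -> above v a = ~~ above a v.
Proof.
move=> av; rewrite /above -opprB upperN // subr_eq0 eq_sym.
by rewrite (inj_eq (@position_inj _ _ D)).
Qed.

Lemma arc_closed E t : E \in edges G -> t \in `[0, 1] ->
  open_arc (curve D E) (curve D E t) \/
  exists2 v, v \in E & curve D E t = position D v.
Proof.
move=> EG; rewrite in_itv /= => /andP[t0 t1].
have [x [y [Exy E0 E1]]] := curve_ends D EG.
move: t0; rewrite le_eqVlt => /predU1P[<-|t0].
  by right; exists x; rewrite ?E0 // Exy !inE eqxx.
move: t1; rewrite le_eqVlt => /predU1P[->|t1].
  by right; exists y; rewrite ?E1 // Exy !inE eqxx orbT.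
by left; exists t => //=; rewrite in_itv /= t0.
Qed.

Lemma curve_neq E F x y : E \in edges G -> F \in edges G ->
  [disjoint E & F]%B -> ~ arcs_meet E F ->
  x \in `[0, 1] -> y \in `[0, 1] -> curve D E x != curve D F y.
Proof.
move=> EG FG dEF nEF xI yI; apply/eqP => exy.
have [Ex|[v vE Ev]] := arc_closed EG xI; have [Fy|[w wF Fw]] := arc_closed FG yI.
- by apply: nEF; exists (curve D E x); rewrite {2}exy.
- by move: Ex; rewrite exy Fw; exact: curve_avoids.
- by move: Fy; rewrite -exy Ev; exact: curve_avoids.
- have /(@position_inj _ _ D) vw : position D v = position D w by rewrite -Ev -Fw.
  by move/disjointFr: dEF => /(_ _ vE); rewrite vw wF.
Qed.

Lemma adj_edge a b : adj a b -> [set a; b]%SET \in edges G.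
Proof. by move=> ab; apply/imsetP; exists (a, b); rewrite ?inE. Qed.

Lemma edge_ends a b : adj a b ->
  curve D [set a; b]%SET 0 = position D a /\
    curve D [set a; b]%SET 1 = position D b \/
  curve D [set a; b]%SET 0 = position D b /\
    curve D [set a; b]%SET 1 = position D a.
Proof.
move=> ab; have [x [y [Exy -> ->]]] := curve_ends D (adj_edge ab).
have nab : a != b by apply: contraTneq ab => ->; rewrite adj_irr.
have : a \in [set x; y]%SET by rewrite -Exy !inE eqxx.
have : b \in [set x; y]%SET by rewrite -Exy !inE eqxx orbT.
rewrite !inE => /orP[/eqP bx|/eqP bx] /orP[/eqP ax|/eqP ax].
- by rewrite ax bx eqxx in nab.
- by right; rewrite ax bx.
- by left; rewrite ax bx.
- by rewrite ax bx eqxx in nab.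
Qed.

Definition edge_parity M E v := arc_parity M (curve D E) (position D v).

Lemma near_edge_parity : \forall M \near \oo, forall a b c d,
  adj a b -> adj c d -> uniq [:: a; b; c; d] ->
  ~ arcs_meet [set a; b]%SET [set c; d]%SET ->
  edge_parity M [set a; b]%SET c (+) edge_parity M [set a; b]%SET d (+)
  edge_parity M [set c; d]%SET a (+) edge_parity M [set c; d]%SET b =
  (above a c (+) above b c) (+) (above a d (+) above b d).
Proof.
apply: filter_forall => a; apply: filter_forall => b.
apply: filter_forall => c; apply: filter_forall => d.
have [ab|] := boolP (adj a b); last by move=> _; near=> M.
have [cd|] := boolP (adj c d); last by move=> _; near=> M.
have [abcd|] := boolP (uniq [:: a; b; c; d]); last by move=> _; near=> M.
have [|ncr] := pselect (arcs_meet [set a; b]%SET [set c; d]%SET).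
  by move=> h; near=> M.
have dis : [disjoint [set a; b]%SET & [set c; d]%SET]%B.
  move: abcd; rewrite /= !inE !negb_or -setI_eq0 => /andP[/and3P[_ ac ad]].
  move=> /andP[/andP[bc bd] _]; apply/eqP/setP => v; rewrite !inE.
  apply/negP => /andP[/orP[]/eqP->]; rewrite ?(negbTE ac) ?(negbTE ad);
    by rewrite ?(negbTE bc) ?(negbTE bd).
have := disjoint_arc_parity (curve_cont (adj_edge ab)) (curve_cont (adj_edge cd))
   (fun x y => curve_neq (adj_edge ab) (adj_edge cd) dis ncr).
apply: filterS => M + _ _ _ _; rewrite /above /edge_parity.
case: (edge_ends ab) => [[-> ->]|[-> ->]]; case: (edge_ends cd) => [[-> ->]|[-> ->]];
  case: (arc_parity _ _ _); case: (arc_parity _ _ _); case: (arc_parity _ _ _);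
  case: (arc_parity _ _ _); case: (upper _); case: (upper _); case: (upper _);
  by case: (upper _).
Unshelve. all: by end_near. Qed.
End DrawingParity.

(** * Obstructions in the pancake graph *)

Section ParityCount.
Local Open Scope nat_scope.

Lemma iter_addb n b : iter n (addb b) false = odd n && b.
Proof. by elim: n => //= n ->; case: b; case: (odd n). Qed.

Definition even_list (T : eqType) (l : seq T) : bool :=
  all (fun x => ~~ odd (count_mem x l)) l.

Lemma big_addb_even (T : eqType) (l : seq T) (f : T -> bool) :
  even_list l -> \big[addb/false]_(x <- l) f x = false.
Proof.
move=> /allP ev; rewrite -big_undup_iterop_count big_seq_cond big1 // => x.
rewrite andbT mem_undup => xl; rewrite Monoid.iteropE iter_addb.
by rewrite (negbTE (ev x xl)).
Qed.

Lemma big_addb_count (T : Type) (l : seq T) (f : pred T) :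
  \big[addb/false]_(x <- l) f x = odd (count f l).
Proof. by elim: l => [|x l IH]; rewrite ?big_nil // big_cons IH /= oddD oddb. Qed.

End ParityCount.

Section Combinatorics.
Local Open Scope nat_scope.

Definition letter_pairs : seq (seq nat) :=
  [seq [:: a; b] | a <- iota 0 4, b <- iota 0 4].

Definition words : seq (seq nat) :=
  [seq w <- [seq p ++ q | p <- letter_pairs, q <- letter_pairs] | uniq w].

Definition flips (w : seq nat) : seq (seq nat) :=
  [seq rev (take k w) ++ drop k w | k <- [:: 2; 3; 4]].

(* Vertices are coded by the ranks in words, an edge by the pair of its ends in
   increasing order, a pair of disjoint edges by the pair of the codes in
   increasing order of the smaller ends. *)
Definition edge_code : Type := nat * nat.

Definition edge_codes : seq edge_code :=
  [seq e <- [seq (i, j) | i <- iota 0 24, j <- iota 0 24] |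
     (e.1 < e.2) && (nth [::] words e.2 \in flips (nth [::] words e.1))].

Definition pair_codes : seq (edge_code * edge_code) :=
  [seq k <- [seq (e, f) | e <- edge_codes, f <- edge_codes] |
     (k.1.1 < k.2.1) && uniq [:: k.1.1; k.1.2; k.2.1; k.2.2]].

Definition normal_edge (i j : nat) : edge_code := (minn i j, maxn i j).

Definition normal_pair (e f : edge_code) : edge_code * edge_code :=
  if e.1 < f.1 then (e, f) else (f, e).

(* A subdivision of K_{3,3}: row i, column j is the path from the i-th vertex of
   the first class to the j-th vertex of the second one. *)
Definition k33 : seq (seq (seq (seq nat))) := [::
  [:: [:: [:: 0;1;2;3]; [:: 1;0;2;3]];
      [:: [:: 0;1;2;3]; [:: 2;1;0;3]];
      [:: [:: 0;1;2;3]; [:: 3;2;1;0]; [:: 1;2;3;0]]];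
  [:: [:: [:: 2;3;0;1]; [:: 3;2;0;1]; [:: 1;0;2;3]];
      [:: [:: 2;3;0;1]; [:: 1;0;3;2]; [:: 3;0;1;2]; [:: 2;1;0;3]];
      [:: [:: 2;3;0;1]; [:: 0;3;2;1]; [:: 1;2;3;0]]];
  [:: [:: [:: 0;2;1;3]; [:: 2;0;1;3]; [:: 1;0;2;3]];
      [:: [:: 0;2;1;3]; [:: 1;2;0;3]; [:: 2;1;0;3]];
      [:: [:: 0;2;1;3]; [:: 3;1;2;0]; [:: 2;1;3;0]; [:: 1;2;3;0]]]].

Definition swap_middle (w : seq nat) : seq nat :=
  if w is [:: a; b; c; d] then [:: a; c; b; d] else w.

(* The relabellings of the letters, possibly preceded by the exchange of the two
   middle letters, which exchanges the reversals of prefixes of lengths 2 and 3. *)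
Definition automorphisms : seq (seq nat -> seq nat) :=
  [seq map (nth 0 s) | s <- words] ++
  [seq (fun w => map (nth 0 s) (swap_middle w)) | s <- words].

Definition path_edges (g : seq nat -> seq nat) (p : seq (seq nat)) :
    seq edge_code :=
  let r := [seq index (g w) words | w <- p] in
  [seq normal_edge e.1 e.2 | e <- zip r (behead r)].

Definition independent_pairs (g : seq nat -> seq nat) :
    seq (edge_code * edge_code) :=
  flatten
    [seq [seq normal_pair e f
           | e <- path_edges g (nth [::] (nth [::] k33 q.1.1) q.1.2),
             f <- path_edges g (nth [::] (nth [::] k33 q.2.1) q.2.2)]
     | q <- [seq ((i.1, j.1), (i.2, j.2))
              | i <- [:: (0, 1); (0, 2); (1, 2)],
                j <- [seq j <- [seq (a, b) | a <- iota 0 3, b <- iota 0 3]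
                       | j.1 != j.2]]].

(* The terms of the equation of near_edge_parity. *)
Definition edge_terms (k : edge_code * edge_code) : seq (edge_code * nat) :=
  [:: (k.1, k.2.1); (k.1, k.2.2); (k.2, k.1.1); (k.2, k.1.2)].

Definition vertex_terms (k : edge_code * edge_code) : seq (nat * nat) :=
  [:: (k.1.1, k.2.1); (k.1.2, k.2.1); (k.1.1, k.2.2); (k.1.2, k.2.2)].

(* For the pairs of such a list l, the equations of near_edge_parity cannot all
   hold: each term edge_parity M E v occurs an even number of times in their sum, and
   so does each term above u v after using above u v = ~~ above v u, which is used an
   odd number of times. *)
Definition obstruction (l : seq (edge_code * edge_code)) : bool :=
  let vs := flatten [seq vertex_terms k | k <- l] in
  [&& all (fun k => k \in pair_codes) l,
      even_list (flatten [seq edge_terms k | k <- l]),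
      even_list [seq normal_edge p.1 p.2 | p <- vs] &
      odd (count (fun p => p.2 < p.1) vs)].

Definition obstructions : seq (seq (edge_code * edge_code)) :=
  [seq independent_pairs g | g <- automorphisms].

Lemma obstructionsP : all obstruction obstructions.
Proof. by vm_compute. Qed.

Lemma obstructions_cover :
  all (fun k => count (fun l => k \in l) obstructions <= 8) pair_codes.
Proof. by vm_compute. Qed.

Lemma uniq_pair_codes : uniq pair_codes.
Proof. by vm_compute. Qed.

Lemma size_obstructions : size obstructions = 48.
Proof. by vm_compute. Qed.

End Combinatorics.

Section WordCodes.
Local Open Scope nat_scope.
Local Notation P4 := (pancake_graph 4).

Definition nat_word (s : 'S_4) : seq nat := map val (word s).

Lemma nat_word_inj : injective nat_word.
Proof.
move=> s t /(inj_map val_inj) st; apply/permP => i.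
by move/eq_in_map: st; apply; rewrite mem_enum.
Qed.

Lemma nat_word_in s : nat_word s \in words.
Proof.
have sz : size (nat_word s) = 4.
  by rewrite 2!size_map size_enum_ord.
have un : uniq (nat_word s).
  by rewrite (map_inj_uniq val_inj) (map_inj_uniq perm_inj) enum_uniq.
have lt4 a : a \in nat_word s -> a \in iota 0 4.
  by case/mapP => x _ ->; rewrite mem_iota ltn_ord.
rewrite /words mem_filter un.
case: (nat_word s) sz lt4 => [|a [|b [|c [|d []]]]] // _ lt4.
apply/allpairsP; exists ([:: a; b], [:: c; d]); split => //=;
  apply/allpairsP; [exists (a, b)|exists (c, d)]; split => //=;
  by apply: lt4; rewrite !inE eqxx ?orbT.
Qed.

Lemma wordsE : words =i [seq nat_word s | s : 'S_4].
Proof.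
have h := @uniq_min_size _ [seq nat_word s | s : 'S_4] words.
have [||//|_ e] := h; last by move=> w; rewrite e.
- by rewrite map_inj_uniq ?enum_uniq //; exact: nat_word_inj.
- by move=> _ /mapP[s _ ->]; exact: nat_word_in.
- by rewrite size_map -cardE card_Sn.
Qed.

Definition vert (i : nat) : P4 :=
  odflt 1%g [pick s : 'S_4 | nat_word s == nth [::] words i].

Lemma vertK i : i < 24 -> nat_word (vert i) = nth [::] words i.
Proof.
move=> i24; rewrite /vert; case: pickP => [s /eqP //|no].
have : nth [::] words i \in words by apply: mem_nth.
by rewrite wordsE => /mapP[s _ /esym/eqP]; rewrite no.
Qed.

Lemma vert_inj i j : i < 24 -> j < 24 -> (vert i == vert j) = (i == j).
Proof.
move=> i24 j24; rewrite -(inj_eq nat_word_inj) !vertK //.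
by rewrite nth_uniq.
Qed.

Lemma vert_surj (s : P4) : exists2 i, i < 24 & s = vert i.
Proof.
have sw := nat_word_in s.
have lt : index (nat_word s) words < 24 by rewrite index_mem.
exists (index (nat_word s) words) => //.
by apply: nat_word_inj; rewrite vertK // nth_index.
Qed.

Lemma pancake_adjE (s t : P4) : adj s t = (nat_word t \in flips (nat_word s)).
Proof.
have mapE k : map val (reverse_prefix k (word s)) =
    rev (take k (nat_word s)) ++ drop k (nat_word s).
  by rewrite map_cat map_rev map_take map_drop.
apply/existsP/mapP => [[k /andP[k2 /eqP st]]|[k kI st]].
  exists (val k); first by case: k k2 {st} => [[|[|[|[|[]]]]]].
  by rewrite -mapE -st.
have k5 : k < 5 by case/or4P: kI => [/eqP->|/eqP->|/eqP->|].
exists (Ordinal k5) => /=; apply/andP; split.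
  by case/or4P: kI => [/eqP->|/eqP->|/eqP->|].
by apply/eqP/(inj_map val_inj); rewrite mapE.
Qed.

Definition edge_set (e : edge_code) : {set P4} := [set vert e.1; vert e.2]%SET.

Lemma mem_edge_codes i j : ((i, j) \in edge_codes) =
  [&& i < 24, j < 24, i < j & nth [::] words j \in flips (nth [::] words i)].
Proof.
rewrite mem_filter; apply/andP/and4P => [[/andP[ij h] /allpairsP[]]|].
  move=> [a b] []; rewrite !mem_iota /= !add0n => a24 b24 [ia jb].
  by rewrite ia jb in ij h *; split.
move=> [i24 j24 ij h]; split; first by rewrite ij.
by apply/allpairsP; exists (i, j); rewrite !mem_iota.
Qed.

Lemma edge_codes_adj e : e \in edge_codes ->
  [/\ e.1 < e.2, e.2 < 24 & adj (vert e.1) (vert e.2)].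
Proof.
case: e => i j; rewrite mem_edge_codes => /and4P[i24 j24 ij h]; split => //.
by rewrite pancake_adjE !vertK.
Qed.

Lemma adj_edge_codes (s t : P4) : adj s t -> exists2 e, e \in edge_codes &
  s = vert e.1 /\ t = vert e.2 \/ s = vert e.2 /\ t = vert e.1.
Proof.
have [i i24 ->] := vert_surj s; have [j j24 ->] := vert_surj t => ij_adj.
case: (ltngtP i j) => ij.
- exists (i, j); last by left.
  by rewrite mem_edge_codes i24 j24 ij -!vertK // -pancake_adjE.
- exists (j, i); last by right.
  by rewrite mem_edge_codes i24 j24 ij -!vertK // -pancake_adjE adj_sym.
- by move: ij_adj; rewrite ij adj_irr.
Qed.

Lemma edge_set_inj : {in edge_codes &, injective edge_set}.
Proof.
move=> [i j] [i' j'] /edge_codes_adj[/= ij j24 _] /edge_codes_adj[/= ij' j24' _].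
have i24 := ltn_trans ij j24; have i24' := ltn_trans ij' j24'.
move/setP => eq.
have := eq (vert i); rewrite !inE eqxx !vert_inj //= => /esym/orP[]/eqP ei.
- subst i'; have := eq (vert j).
  rewrite !inE eqxx orbT !vert_inj // => /esym/orP[]/eqP ej; last by rewrite ej.
  by rewrite ej ltnn in ij.
- subst j'; have := eq (vert i'); rewrite !inE eqxx !vert_inj //= => /orP[]/eqP ej.
    by rewrite ej ltnn in ij'.
  by rewrite ej ltnNge (ltnW ij) in ij'.
Qed.

Lemma mem_pair_codes k : (k \in pair_codes) =
  [&& k.1 \in edge_codes, k.2 \in edge_codes, k.1.1 < k.2.1 &
      uniq [:: k.1.1; k.1.2; k.2.1; k.2.2]].
Proof.
rewrite mem_filter; apply/andP/and4P => [[/andP[lt un] /allpairsP[]]|].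
  by move=> [e f] [eE fE kE]; rewrite kE in lt un *; split.
case: k => e f [eE fE lt un]; split; first by apply/andP; split.
by apply/allpairsP; exists (e, f).
Qed.

Definition pair_set (k : edge_code * edge_code) : {set {set P4}} :=
  [set edge_set k.1; edge_set k.2]%SET.

Lemma pair_set_inj : {in pair_codes &, injective pair_set}.
Proof.
move=> [e f] [e' f'].
rewrite !mem_pair_codes => /and4P[/= eE fE lt _] /and4P[/= eE' fE' lt' _].
move/setP => eq; have := eq (edge_set e); rewrite !inE eqxx /= => /esym/orP[].
- move=> /eqP/(edge_set_inj eE eE') ee'; subst e'; congr (_, _).
  have := eq (edge_set f); rewrite !inE eqxx orbT => /esym/orP[]/eqP.
    by move/(edge_set_inj fE eE) => fe; rewrite fe ltnn in lt.
  exact: edge_set_inj.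
- move=> /eqP/(edge_set_inj eE fE') ef; subst f'.
  have := eq (edge_set e'); rewrite !inE eqxx => /= /orP[]/eqP.
    by move/(edge_set_inj eE' eE) => ee; rewrite ee ltnn in lt'.
  by move/(edge_set_inj eE' fE) => ef; rewrite ef ltnNge ltnW in lt'.
Qed.

End WordCodes.

Section LowerBound.
Variables (R : realType) (D : drawing R (pancake_graph 4)).
Local Notation P4 := (pancake_graph 4).

Definition meeting (k : edge_code * edge_code) : bool :=
  `[< arcs_meet D (edge_set k.1) (edge_set k.2) >].

Lemma obstruction_meeting l : obstruction l -> has meeting l.
Proof.
case/and4P => /allP lP evE evV odV; apply/negPn/negP => /hasPn no.
have [M _ /(_ M (leqnn M)) par] := near_edge_parity D.
pose N (x : edge_code * nat) := edge_parity D M (edge_set x.1) (vert x.2).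
pose t (x : nat * nat) := above D (vert x.1) (vert x.2).
have X k : k \in l -> \big[addb/false]_(x <- edge_terms k) N x =
    \big[addb/false]_(x <- vertex_terms k) t x.
  move=> kl; have := lP _ kl; rewrite mem_pair_codes => /and4P[eE fE lt un].
  have [e12 e24 ae] := edge_codes_adj eE; have [f12 f24 af] := edge_codes_adj fE.
  have nm : ~ arcs_meet D (edge_set k.1) (edge_set k.2) by apply/asboolPn/no.
  have lt24 i : i \in [:: k.1.1; k.1.2; k.2.1; k.2.2] -> (i < 24)%N.
    rewrite !inE => /or4P[] /eqP->;
      by rewrite ?e24 ?f24 ?(ltn_trans e12 e24) ?(ltn_trans f12 f24).
  have un' : uniq [:: vert k.1.1; vert k.1.2; vert k.2.1; vert k.2.2].
    rewrite -[X in uniq X]/(map vert [:: k.1.1; k.1.2; k.2.1; k.2.2]).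
    rewrite map_inj_in_uniq // => i j /lt24 i24 /lt24 j24 /eqP.
    by rewrite vert_inj // => /eqP.
  have := par _ _ _ _ ae af un' nm.
  by rewrite !big_cons !big_nil /N /t /= !addbF -!addbA.
set vs := flatten [seq vertex_terms k | k <- l] in evV odV.
have : \big[addb/false]_(x <- vs) t x = false.
  apply: etrans (big_addb_even N evE); rewrite /vs !big_flatten !big_map.
  by apply: eq_big_seq => k kl; rewrite X.
have tE x : x \in vs -> t x = t (normal_edge x.1 x.2) (+) (x.2 < x.1)%N.
  case/flatten_mapP => k kl xk.
  have := lP _ kl; rewrite mem_pair_codes => /and4P[eE fE lt un].
  have [e12 e24 _] := edge_codes_adj eE; have [f12 f24 _] := edge_codes_adj fE.
  have [x1 x2 x12] : [/\ (x.1 < 24)%N, (x.2 < 24)%N & x.1 != x.2].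
    move: un xk; rewrite /= !inE !negb_or => /andP[/and3P[_ n1 n2]].
    move=> /andP[/andP[n3 n4] _].
    have := (ltn_trans e12 e24, ltn_trans f12 f24) => -[e1 f1].
    by case/or4P => /eqP-> /=.
  rewrite /t /normal_edge /=; case: (ltngtP x.1 x.2) x12 => //= lt12 _.
    by rewrite addbF.
  have v12 : vert x.1 != vert x.2 by rewrite vert_inj // neq_ltn lt12 orbT.
  by rewrite addbT (aboveC D v12) negbK.
have evt := big_addb_even t evV; rewrite big_map in evt.
by rewrite (eq_big_seq _ tE) big_split /= evt big_addb_count odV.
Qed.

(* Double counting: each of the 48 obstructions contains a pair of edges that
   meet, and no pair of edges is in more than 8 of them. *)
Lemma six_meeting_pairs : (6 <= count meeting pair_codes)%N.
Proof.
rewrite -(leq_pmul2r (isT : 0 < 8)%N) -[(6 * 8)%N]/48%N.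
rewrite -size_obstructions -sum1_size.
rewrite -sum1_count big_distrl /=.
apply: (@leq_trans
  (\sum_(k <- pair_codes | meeting k) \sum_(l <- obstructions) (k \in l))).
  rewrite exchange_big /= !big_seq; apply: leq_sum => l lO.
  have ob := allP obstructionsP _ lO.
  have /hasP[k kl mk] := obstruction_meeting ob.
  have kP : k \in pair_codes by case/and4P: ob => /allP/(_ _ kl).
  by rewrite lt0n sum_nat_seq_eq0; apply/allPn; exists k; rewrite // mk kl.
rewrite big_seq_cond [leqRHS]big_seq_cond; apply: leq_sum => k /andP[kP _].
have := allP obstructions_cover k kP; apply: leq_trans.
by rewrite -sum1_count [leqRHS]big_mkcond /=; apply: leq_sum => l _; case: (_ \in _).
Qed.

Lemma size_le_crossing_count (K : seq (edge_code * edge_code)) :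
  uniq K -> {subset K <= pair_codes} -> all meeting K ->
  (size K <= crossing_count D)%N.
Proof.
move=> uK Kpc /allP Km.
have /choice[z zP] k : exists z : R * R, meeting k ->
    open_arc (curve D (edge_set k.1)) z /\ open_arc (curve D (edge_set k.2)) z.
  by case: (boolP (meeting k)) => [/asboolP[z zP]|_]; [exists z|exists 0].
pose c k := (pair_set k, z k).
have <- : #|` [fset x in map c K]%fset| = size K.
  rewrite card_fseq undup_id ?size_map // map_inj_in_uniq //.
  by move=> k k' /Kpc kP /Kpc kP' /(congr1 fst); exact: pair_set_inj.
rewrite /crossing_count; apply/fsubset_leq_card/fsubsetP => x.
rewrite in_fset => /mapP[k kK ->].
have := Kpc k kK; rewrite mem_pair_codes => /and4P[eE fE lt _].
rewrite in_fset_set ?inE; last exact: crossings_finite.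
have [z1 z2] := zP k (Km k kK).
have edgeP e : e \in edge_codes -> edge_set e \in edges P4.
  by move=> /edge_codes_adj[_ _]; exact: adj_edge.
exists (edge_set k.1), (edge_set k.2); split => //; split => //; try exact: edgeP.
by apply/eqP => /(edge_set_inj eE fE) ef; rewrite ef ltnn in lt.
Qed.

Lemma crossing_count_ge6 : (6 <= crossing_count D)%N.
Proof.
apply: (leq_trans six_meeting_pairs); rewrite -size_filter.
apply: size_le_crossing_count; first exact: filter_uniq uniq_pair_codes.
- by move=> k; rewrite mem_filter => /andP[].
- exact: filter_all.
Qed.

End LowerBound.

(** * Drawings with straight edges *)

Definition orient (R : comPzRingType) (a b c : R * R) : R := det (b - a) (c - a).

Section Segments.
Variable R : realType.
Implicit Types (a b c d p q u w : R * R) (s t x y : R).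

Definition segment a b t : R * R := a + t *: (b - a).

Lemma continuous_pair (T : topologicalType) (f g : T -> R) :
  continuous f -> continuous g -> continuous (fun z => (f z, g z)).
Proof. by move=> cf cg z; exact: (cvg_pair (cf z) (cg z)). Qed.

Lemma continuous_segment a b : continuous (segment a b).
Proof.
move=> t; rewrite /continuous_at /segment.
by apply: cvgD; [exact: cvg_cst|apply: cvgZr_tmp; exact: cvg_id].
Qed.

Lemma continuous_affine (k l m : R) :
  continuous (fun q : R * R => k * q.1 + l * q.2 + m).
Proof.
move=> q; apply: cvgD; last exact: cvg_cst.
by apply: cvgD; apply: cvgM; (exact: cvg_cst || exact: cvg_fst || exact: cvg_snd).
Qed.

Lemma segment_inj a b : a != b -> injective (segment a b).
Proof.
rewrite eq_sym -subr_eq0 => ab s t /addrI /eqP.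
by rewrite -subr_eq0 -scalerBl scaler_eq0 (negbTE ab) orbF subr_eq0 => /eqP.
Qed.

Lemma orient_segment a b t : orient a b (segment a b t) = 0.
Proof. by rewrite /orient /det /segment /= /GRing.scale /=; ring. Qed.

Lemma orient_affine a b c d t :
  orient a b (segment c d t) = (1 - t) * orient a b c + t * orient a b d.
Proof. by rewrite /orient /det /segment /= /GRing.scale /=; ring. Qed.

Lemma open_segmentC a b : open_arc (segment a b) = open_arc (segment b a).
Proof.
have sub u w p : open_arc (segment u w) p -> open_arc (segment w u) p.
  move=> [t] /=; rewrite in_itv /= => /andP[t0 t1] <-; exists (1 - t).
    by rewrite /= in_itv /= subr_gt0 t1 ltrBlDr ltrDl.
  by rewrite /segment; congr (_, _); rewrite /= /GRing.scale /=; ring.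
by apply/seteqP; split => p; exact: sub.
Qed.

Lemma segments_separated a b c d p : 0 < orient a b c * orient a b d ->
  open_arc (segment a b) p -> ~ open_arc (segment c d) p.
Proof.
move=> cd_gt0 [s _ sp] [t] /=; rewrite in_itv /= => /andP[t0 t1] tp.
have : orient a b p = 0 by rewrite -sp orient_segment.
rewrite -tp orient_affine => o0.
have o1 : 0 < (1 - t) * orient a b c ^+ 2.
  rewrite mulr_gt0 ?subr_gt0 // exprn_even_gt0 //=.
  by apply: contraTneq cd_gt0 => ->; rewrite mul0r ltxx.
have := mulr_gt0 t0 cd_gt0; have := congr1 ( *%R (orient a b c)) o0.
by rewrite mulr0; nra.
Qed.

Lemma det_coordinates u w v : det u w != 0 ->
  v = (det v w / det u w) *: u + (det u v / det u w) *: w.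
Proof.
case: u w v => u1 u2 [w1 w2] [v1 v2]; rewrite /det /= => nz.
congr (_, _) => /=; rewrite /GRing.scale /=; field; exact: nz.
Qed.

Lemma coordinatesK u w x y : det u w != 0 ->
  (det (x *: u + y *: w) w / det u w, det u (x *: u + y *: w) / det u w) = (x, y).
Proof.
case: u w => u1 u2 [w1 w2] nz; apply/eqP; rewrite xpair_eqE.
rewrite !(can2_eq (divfK nz) (mulfK nz)) /det /= /GRing.scale /=.
by apply/andP; split; apply/eqP; ring.
Qed.

Lemma segments_cross a b c d p s t :
  det (b - a) (d - c) != 0 -> s \in `]0, 1[ -> t \in `]0, 1[ ->
  p = segment a b s -> p = segment c d t ->
  crosses_at (open_arc (segment a b)) (open_arc (segment c d)) p.
Proof.
set u := b - a; set w := d - c => nz.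
rewrite !in_itv /= => /andP[s0 s1] /andP[t0 t1].
move=> ps pt.
pose V : set (R * R) := `]- s, 1 - s[ `*` `]- t, 1 - t[.
pose h q := (det (q - p) w / det u w, det u (q - p) / det u w).
pose g (z : R * R) := p + (z.1 *: u + z.2 *: w).
have ch : continuous h.
  apply: continuous_pair.
  - rewrite (_ : (fun q => _) = fun q => w.2 / det u w * q.1 +
      (- w.1 / det u w) * q.2 + det (- p) w / det u w);
      first exact: continuous_affine.
    by apply/funext => q; rewrite /det /=; ring.
  - rewrite (_ : (fun q => _) = fun q => - u.2 / det u w * q.1 +
      (u.1 / det u w) * q.2 + det u (- p) / det u w);
      first exact: continuous_affine.
    by apply/funext => q; rewrite /det /=; ring.
have cg : continuous g.
  rewrite (_ : g = fun z =>
    (u.1 * z.1 + w.1 * z.2 + p.1, u.2 * z.1 + w.2 * z.2 + p.2)).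
    by apply: continuous_pair; exact: continuous_affine.
  by apply/funext => z; rewrite /g; congr (_, _); rewrite /= /GRing.scale /=; ring.
have oV : open V.
  apply: openI; apply: open_comp; try exact: itv_open.
  - by move=> z _; exact: cvg_fst.
  - by move=> z _; exact: cvg_snd.
have hg z : h (g z) = z.
  by case: z => x y; rewrite /h /g [p + _]addrC addrK coordinatesK.
have gh q : g (h q) = q.
  by rewrite /g /h /= -det_coordinates // addrC subrK.
exists (h @^-1` V), V, h, g; split; first split.
- by apply: open_comp => // q _; exact: ch.
- exact: oV.
- rewrite /V /h /= subrr /det /= !mul0r !mulr0 subrr mul0r !in_itv /=.
  by rewrite !oppr_lt0 !subr_gt0 s0 s1 t0 t1.
- rewrite /h subrr /det /= !mul0r !mulr0 subrr mul0r //.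
split; first split.
- exact: continuous_subspaceT.
- exact: continuous_subspaceT.
- by move=> q Vq; rewrite gh.
- by move=> q Vq; rewrite /= hg.
move=> q Vq; have {Vq} : V (h q) by [].
have := gh q; rewrite /V; case hq: (h q) => [x y] gq /=.
rewrite !in_itv /= => -[/andP[x0 x1] /andP[y0 y1]]; split; split.
- case=> s' _ s'q; move: hq => [_ <-]; rewrite -s'q ps /segment /u /det /=.
  by rewrite /GRing.scale /=; ring.
- move=> y00; exists (s + x).
    by rewrite /= in_itv /= addrC -ltrBlDr sub0r x0 -ltrBrDr.
  rewrite -gq /g y00 scale0r addr0 ps /segment scalerDl addrA //.
- case=> t' _ t'q; move: hq => [<- _]; rewrite -t'q pt /segment /w /det /=.
  by rewrite /GRing.scale /=; ring.
- move=> x00; exists (t + y).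
    by rewrite /= in_itv /= addrC -ltrBlDr sub0r y0 -ltrBrDr.
  rewrite -gq /g x00 scale0r add0r pt /segment scalerDl addrA //.
Qed.

End Segments.

Section StraightDrawing.
Variables (R : realType) (G : sgraph) (pos : G -> R * R).
Hypothesis pos_inj : injective pos.
Hypothesis general_position : forall a b v, adj a b -> v != a -> v != b ->
  orient (pos a) (pos b) (pos v) != 0.
Implicit Types (a b c d v : G) (E F : {set G}) (p q : R * R).

Definition straight_curve E : R -> R * R :=
  if [pick e : G * G | adj e.1 e.2 && (E == [set e.1; e.2]%SET)] is Some e
  then segment (pos e.1) (pos e.2) else cst 0.

Lemma straight_curveP E : E \in edges G -> exists a b,
  [/\ adj a b, E = [set a; b]%SET & straight_curve E = segment (pos a) (pos b)].
Proof.
case/imsetP => -[x y]; rewrite inE => /= xy Exy; rewrite /straight_curve.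
case: pickP => [[a b] /= /andP[ab /eqP Eab]|/(_ (x, y))]; first by exists a, b.
by rewrite /= xy Exy eqxx.
Qed.

Lemma adj_neq a b : adj a b -> a != b.
Proof. by apply: contraTneq => ->; rewrite adj_irr. Qed.

Lemma open_segmentP (a b p : R * R) :
  open_arc (segment a b) p -> exists2 t, 0 < t < 1 & p = a + t *: (b - a).
Proof. by case=> t /=; rewrite in_itv /= => t01 <-; exists t. Qed.

Lemma straight_avoids E v : E \in edges G -> ~ open_arc (straight_curve E) (pos v).
Proof.
move=> /straight_curveP[a [b [ab _ ->]]] /[dup] op /open_segmentP[t /andP[t0 t1] pv].
have nab : pos a != pos b by rewrite (inj_eq pos_inj) adj_neq.
have [va|va] := eqVneq v a.
  have : segment (pos a) (pos b) t = segment (pos a) (pos b) 0.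
    by rewrite /segment -pv scale0r addr0 va.
  by move/(segment_inj nab) => t00; rewrite t00 ltxx in t0.
have [vb|vb] := eqVneq v b.
  have : segment (pos a) (pos b) t = segment (pos a) (pos b) 1.
    by rewrite /segment -pv scale1r [RHS]addrC subrK vb.
  by move/(segment_inj nab) => t00; rewrite t00 ltxx in t1.
by have := general_position ab va vb; rewrite pv orient_segment eqxx.
Qed.

(* Two edges on parallel lines that meet would lie on one line, so that the ends
   of the second edge would be those of the first one. *)
Lemma straight_transverse a b c d p : adj a b -> adj c d ->
  [set a; b]%SET != [set c; d]%SET ->
  open_arc (segment (pos a) (pos b)) p -> open_arc (segment (pos c) (pos d)) p ->
  det (pos b - pos a) (pos d - pos c) != 0.
Proof.
move=> ab cd neq /open_segmentP[s s01 ps] /open_segmentP[t t01 pt].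
apply/eqP => det0.
have col v r : pos v = p + r *: (pos d - pos c) -> v = a \/ v = b.
  move=> vE; have [->|va] := eqVneq v a; first by left.
  have [->|vb] := eqVneq v b; first by right.
  case/eqP: (general_position ab va vb).
  have -> : orient (pos a) (pos b) (pos v) = r * det (pos b - pos a) (pos d - pos c).
    by rewrite vE ps /orient /det /= /GRing.scale /=; ring.
  by rewrite det0 mulr0.
have cab : c = a \/ c = b.
  by apply: (col c (- t)); rewrite pt scaleNr addrK.
have dab : d = a \/ d = b.
  apply: (col d (1 - t)); rewrite pt -addrA -scalerDl [t + _]addrC subrK.
  by rewrite scale1r addrC subrK.
have ncd := adj_neq cd.
case: cab dab ncd neq => -> [] ->; rewrite ?eqxx //.
by rewrite finset.setUC eqxx.
Qed.

Lemma straight_shared a b d p : adj a b -> adj a d -> b != d ->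
  open_arc (segment (pos a) (pos b)) p -> ~ open_arc (segment (pos a) (pos d)) p.
Proof.
move=> ab ad bd /open_segmentP[s _ ->] /open_segmentP[t /andP[t0 _] st].
have da : d != a by rewrite eq_sym adj_neq.
have db : d != b by rewrite eq_sym.
suff : t * orient (pos a) (pos b) (pos d) = 0.
  by move/eqP; rewrite mulf_eq0 (gt_eqF t0) (negbTE (general_position ab da db)).
have -> : t * orient (pos a) (pos b) (pos d) =
    det (pos b - pos a) (pos a + t *: (pos d - pos a) - pos a).
  by rewrite /orient /det /= /GRing.scale /=; ring.
by rewrite -st /det /= /GRing.scale /=; ring.
Qed.

Lemma straight_meet_disjoint a b c d p : adj a b -> adj c d ->
  [set a; b]%SET != [set c; d]%SET ->
  open_arc (segment (pos a) (pos b)) p -> open_arc (segment (pos c) (pos d)) p ->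
  uniq [:: a; b; c; d].
Proof.
move=> ab cd neq pab pcd.
have [ba dc] : adj b a /\ adj d c by split; rewrite adj_sym.
have [pba pdc] : open_arc (segment (pos b) (pos a)) p /\
    open_arc (segment (pos d) (pos c)) p by split; rewrite open_segmentC.
have neqC : [set b; a]%SET != [set c; d]%SET by rewrite finset.setUC.
rewrite /= !inE !negb_or (adj_neq ab) (adj_neq cd) /= !andbT.
apply/andP; split; apply/andP; split.
- apply/eqP => ac; subst c; apply: (straight_shared ab cd _ pab pcd).
  by apply: contraNneq neq => ->.
- apply/eqP => ad; subst d; apply: (straight_shared ab dc _ pab pdc).
  by apply: contraNneq neq => ->; rewrite finset.setUC.
- apply/eqP => bc; subst c; apply: (straight_shared ba cd _ pba pcd).
  by apply: contraNneq neqC => ->.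
- apply/eqP => bd; subst d; apply: (straight_shared ba dc _ pba pdc).
  by apply: contraNneq neqC => ->; rewrite finset.setUC.
Qed.

Lemma straight_meet_uniq E F p q : E \in edges G -> F \in edges G -> E != F ->
  open_arc (straight_curve E) p -> open_arc (straight_curve F) p ->
  open_arc (straight_curve E) q -> open_arc (straight_curve F) q -> p = q.
Proof.
move=> /straight_curveP[a [b [ab -> ->]]] /straight_curveP[c [d [cd -> ->]]] neq.
move=> pab pcd; have nz := straight_transverse ab cd neq pab pcd.
move: pab pcd => /open_segmentP[s _ ->] /open_segmentP[t _ st].
move=> /open_segmentP[s' _ ->] /open_segmentP[t' _ st'].
suff : (s - s') * det (pos b - pos a) (pos d - pos c) = 0.
  by move/eqP; rewrite mulf_eq0 (negbTE nz) orbF subr_eq0 => /eqP->.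
have -> : (s - s') * det (pos b - pos a) (pos d - pos c) =
  det (pos a + s *: (pos b - pos a) - (pos a + s' *: (pos b - pos a)))
    (pos d - pos c).
  by rewrite /det /= /GRing.scale /=; ring.
by rewrite st st' /det /= /GRing.scale /=; ring.
Qed.

Lemma straight_proper E F p : E \in edges G -> F \in edges G -> E != F ->
  open_arc (straight_curve E) p -> open_arc (straight_curve F) p ->
  crosses_at (open_arc (straight_curve E)) (open_arc (straight_curve F)) p.
Proof.
move=> /straight_curveP[a [b [ab -> ->]]] /straight_curveP[c [d [cd -> ->]]] neq.
move=> pab pcd; have nz := straight_transverse ab cd neq pab pcd.
move: (pab) (pcd) => [s s01 ps] [t t01 pt].
exact: (segments_cross nz s01 t01 (esym ps) (esym pt)).
Qed.

Lemma straight_crossing_inj :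
  {in crossings straight_curve &, injective fst}.
Proof.
move=> [X p] [Y q]; rewrite !inE => -[E [F [[/= EG FG neq XE] [pE pF]]]].
move=> [E' [F' [[/= _ _ _ YE] [qE qF]]]] XY.
have mem Z : Z \in X -> open_arc (straight_curve Z) q.
  by rewrite XY YE !inE => /orP[]/eqP->.
congr (_, _) => //; apply: (straight_meet_uniq EG FG neq pE pF); apply: mem.
  by rewrite XE !inE eqxx.
by rewrite XE !inE eqxx orbT.
Qed.

Lemma straight_crossings_finite : finite_set (crossings straight_curve).
Proof.
pose A := crossings straight_curve.
pose f (X : {set {set G}}) := (X, xget 0 [set p | A (X, p)]).
apply: (@sub_finite_set _ _ (f @` setT)); last first.
  by apply: finite_image; exact: finite_finset.
move=> [X p] Xp; exists X => //; rewrite /f.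
have Af : A (X, xget 0 [set p | A (X, p)]).
  exact: (@xgetI _ 0 [set p | A (X, p)] p).
by apply: straight_crossing_inj; rewrite ?inE.
Qed.

Lemma straight_cont E : E \in edges G ->
  {within `[0, 1], continuous (straight_curve E)}.
Proof.
move=> /straight_curveP[a [b [_ _ ->]]].
by apply: continuous_subspaceT; exact: continuous_segment.
Qed.

Lemma straight_simple E : E \in edges G ->
  {in `[0, 1]%R &, injective (straight_curve E)}.
Proof.
move=> /straight_curveP[a [b [ab _ ->]]] s t _ _.
by apply: segment_inj; rewrite (inj_eq pos_inj) adj_neq.
Qed.

Lemma straight_ends E : E \in edges G -> exists x y : G,
  [/\ E = [set x; y]%SET, straight_curve E 0 = pos x & straight_curve E 1 = pos y].
Proof.
move=> /straight_curveP[a [b [ab -> ->]]]; exists a, b; split => //.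
  by rewrite /segment scale0r addr0.
by rewrite /segment scale1r addrC subrK.
Qed.

Definition straight_drawing : drawing R G :=
  Drawing pos_inj straight_cont straight_simple straight_ends straight_avoids
    straight_proper straight_crossings_finite.

Lemma straight_crossing_count (S : seq {set {set G}}) :
  (forall a b c d p, adj a b -> adj c d -> uniq [:: a; b; c; d] ->
     open_arc (segment (pos a) (pos b)) p -> open_arc (segment (pos c) (pos d)) p ->
     [set [set a; b]; [set c; d]]%SET \in S) ->
  (crossing_count straight_drawing <= size S)%N.
Proof.
move=> inS; rewrite /crossing_count; set X := fset_set _.
have XP x : x \in X -> crossings straight_curve x.
  by rewrite in_fset_set ?inE //; exact: straight_crossings_finite.
have <- : #|` [fset x.1 | x in X]%fset| = #|` X|.
  apply: card_in_imfset => x y /XP xA /XP yA.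
  by apply: straight_crossing_inj; rewrite inE.
apply: (@leq_trans #|` [fset x in S]%fset|); last by rewrite card_fseq size_undup.
apply/fsubset_leq_card/fsubsetP => _ /imfsetP[x /= /XP xA ->]; rewrite in_fset.
case: xA => E [F [[EG FG neq ->] []]].
move: EG FG neq => /straight_curveP[a [b [ab -> ->]]].
move=> /straight_curveP[c [d [cd -> ->]]] neq pE pF; exact: inS ab cd (straight_meet_disjoint ab cd neq pE pF) pE pF.
Qed.

End StraightDrawing.

Section Layout.
Local Open Scope nat_scope.

(* Found by a numerical search. *)
Definition coordinates : seq (nat * nat) :=
  [:: (0, 12); (8, 11); (0, 0); (12, 11); (3, 3); (11, 5);
      (6, 11); (9, 10); (5, 1); (13, 4); (7, 6); (12, 12);
      (2, 7); (7, 4); (1, 1); (13, 2); (11, 10); (9, 13);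
      (4, 5); (10, 8); (2, 6); (14, 2); (9, 12); (14, 14)].

Definition place (i : nat) : int * int :=
  let p := nth (0, 0) coordinates i in (Posz p.1, Posz p.2).

Definition separated (k : edge_code * edge_code) : bool :=
  let o i j l := orient (place i) (place j) (place l) in
  ((0 < o k.1.1 k.1.2 k.2.1 * o k.1.1 k.1.2 k.2.2) ||
   (0 < o k.2.1 k.2.2 k.1.1 * o k.2.1 k.2.2 k.1.2))%R.

Definition crossing_codes : seq (edge_code * edge_code) :=
  [seq k <- pair_codes | ~~ separated k].

Lemma size_crossing_codes : size crossing_codes = 6.
Proof. by vm_compute. Qed.

Lemma uniq_coordinates : uniq coordinates.
Proof. by []. Qed.

Lemma place_general : all (fun e => all (fun v => [|| v == e.1, v == e.2 |
  orient (place e.1) (place e.2) (place v) != 0%R]) (iota 0 24)) edge_codes.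
Proof. by vm_compute. Qed.

End Layout.

Section Drawing.
Variable R : realType.
Local Notation P4 := (pancake_graph 4).

Definition rank (s : P4) : nat := index (nat_word s) words.

Definition point (i : nat) : R * R := ((place i).1%:~R, (place i).2%:~R).

Lemma orient_point i j k :
  orient (point i) (point j) (point k) = (orient (place i) (place j) (place k))%:~R.
Proof. by rewrite /orient /det /= !(rmorphB, rmorphM). Qed.

Lemma rankK i : (i < 24)%N -> rank (vert i) = i.
Proof. by move=> i24; rewrite /rank vertK // index_uniq. Qed.

Definition layout (s : P4) : R * R := point (rank s).

Lemma layout_inj : injective layout.
Proof.
move=> s t []; rewrite /layout /point.
have [i i24 ->] := vert_surj s; have [j j24 ->] := vert_surj t.
rewrite !rankK // => /intr_inj[e1] /intr_inj[e2]; congr vert.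
apply/eqP; rewrite -(nth_uniq (0, 0)%N _ _ uniq_coordinates) //.
by apply/eqP; case: (nth _ _ i) (nth _ _ j) e1 e2 => ? ? [? ?] /= -> ->.
Qed.

Lemma layout_general a b v : adj a b -> v != a -> v != b ->
  orient (layout a) (layout b) (layout v) != 0.
Proof.
move=> ab; have [e eE eab] := adj_edge_codes ab.
have [l l24 ->] := vert_surj v.
have [e12 e24 _] := edge_codes_adj eE; have e14 := ltn_trans e12 e24.
have := allP (allP place_general _ eE) l; rewrite mem_iota add0n l24 => /(_ isT).
rewrite -(intr_eq0 R) -orient_point.
rewrite /layout; case: eab => -[-> ->]; rewrite !vert_inj // !rankK //.
  by case/or3P => [->|->|].
case/or3P => [->|->|] // nz _ _.
suff -> : orient (point e.2) (point e.1) (point l) =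
    - orient (point e.1) (point e.2) (point l).
  by rewrite oppr_eq0.
by rewrite /orient /det /=; ring.
Qed.

Lemma meet_crossing_codes k p : k \in pair_codes ->
  open_arc (segment (point k.1.1) (point k.1.2)) p ->
  open_arc (segment (point k.2.1) (point k.2.2)) p -> k \in crossing_codes.
Proof.
move=> kP p1 p2; rewrite mem_filter kP andbT; apply/negP => /orP[].
  by rewrite -(ltr0z R) intrM -!orient_point => /segments_separated/(_ p1 p2).
by rewrite -(ltr0z R) intrM -!orient_point => /segments_separated/(_ p2 p1).
Qed.

Lemma adj_layout a b : adj a b -> exists2 e, e \in edge_codes &
  [set a; b]%SET = edge_set e /\
  open_arc (segment (layout a) (layout b)) =
    open_arc (segment (point e.1) (point e.2)).
Proof.
move=> ab; have [e eE eab] := adj_edge_codes ab; exists e => //.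
have [e12 e24 _] := edge_codes_adj eE; have e14 := ltn_trans e12 e24.
rewrite /layout; case: eab => -[-> ->]; rewrite !rankK //; split => //.
  by rewrite finset.setUC.
by rewrite open_segmentC.
Qed.

Lemma crossing_count_le6 :
  (crossing_count (straight_drawing layout_inj layout_general) <= 6)%N.
Proof.
rewrite -size_crossing_codes -(size_map pair_set).
have := @map_f _ _ pair_set crossing_codes.
move: (map pair_set crossing_codes) => S inS.
apply: straight_crossing_count => a b c d p ab cd.
have [e eE [eab pab]] := adj_layout ab; have [f fE [fcd pcd]] := adj_layout cd.
move=> un pe pf.
have pe' : open_arc (segment (point e.1) (point e.2)) p by rewrite -pab.
have pf' : open_arc (segment (point f.1) (point f.2)) p by rewrite -pcd.
have [e12 e24 _] := edge_codes_adj eE; have [f12 f24 _] := edge_codes_adj fE.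
have disj i : vert i \in edge_set e -> vert i \notin edge_set f.
  rewrite -eab -fcd !inE; move: un; rewrite /= !inE !negb_or.
  move=> /andP[/and3P[_ ac ad] /andP[/andP[bc bd] _]].
  by case/orP=> /eqP->; rewrite ?ac ?ad ?bc ?bd.
have /norP[n11 n12] : ~~ ((f.1 == e.1) || (f.2 == e.1)).
  have := disj e.1; rewrite !inE eqxx /= => /(_ isT).
  by apply: contra => /orP[]/eqP->; rewrite eqxx ?orbT.
have /norP[n21 n22] : ~~ ((f.1 == e.2) || (f.2 == e.2)).
  have := disj e.2; rewrite !inE eqxx orbT => /(_ isT).
  by apply: contra => /orP[]/eqP->; rewrite eqxx ?orbT.
have -> : [set [set a; b]; [set c; d]]%SET = pair_set (e, f).
  by rewrite /pair_set -eab -fcd.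
case: (ltngtP e.1 f.1) => ef; last by rewrite ef eqxx in n11.
- apply: inS; apply: (@meet_crossing_codes (e, f) p _ pe' pf').
  rewrite mem_pair_codes eE fE ef /= !inE !negb_or (ltn_eqF e12) (ltn_eqF f12).
  by rewrite ![_ == f.1]eq_sym ![_ == f.2]eq_sym n11 n12 n21 n22.
- have -> : pair_set (e, f) = pair_set (f, e) by rewrite /pair_set finset.setUC.
  apply: inS; apply: (@meet_crossing_codes (f, e) p _ pf' pe').
  rewrite mem_pair_codes eE fE ef /= !inE !negb_or (ltn_eqF e12) (ltn_eqF f12).
  by rewrite n11 n12 n21 n22.
Qed.

End Drawing.

Local Close Scope ring_scope.
Local Close Scope classical_set_scope.

Theorem theorem3p1 (R : realType) : crossing_number R (pancake_graph 4) = 6.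
Proof.
pose D := straight_drawing (@layout_inj R) (@layout_general R).
have D6 : crossing_count D = 6.
  by apply/eqP; rewrite eqn_leq crossing_count_le6 crossing_count_ge6.
rewrite /crossing_number; case: xgetP => [k _ [[D' <-] minD']|/(_ 6)[]].
  by apply/eqP; rewrite eqn_leq crossing_count_ge6 andbT -D6 minD'.
by split; [exists D|exact: crossing_count_ge6].
Qed.
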